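(* Let $\mathfrak{su}(2)$ be the real Lie algebra with basis $\{u,v,w\}$ and brackets $[u,v]=w$, $[v,w]=u$, $[w,u]=v$. The set of isomorphism classes of Lie bialgebras with underlying Lie algebra $\mathfrak{su}(2)$ is given by the 1-parameter family of cobrackets (matrices with respect to the bases $\{u,v,w\}$ and $\{u\wedge v,\,v\wedge w,\,w\wedge u\}$) $$\delta_\alpha=\begin{pmatrix}0&0&0\\0&\alpha&0\\-\alpha&0&0\end{pmatrix},\quad \alpha\ge 0;$$ that is, each $\delta_\alpha$ is a Lie bialgebra cobracket and every real Lie bialgebra with underlying Lie algebra $\mathfrak{su}(2)$ is isomorphic to $(\mathfrak{su}(2),\delta_\alpha)$ for exactly one $\alpha\ge0$. Moreover, for each $\alpha\neq 0$, the automorphism group of the Lie bialgebra $(\mathfrak{su}(2),\delta_\alpha)$ is, as a group of matrices in the basis $\{u,v,w\}$, $$\left\{\begin{pmatrix}a^2-c^2&-2ac&0\\2ac&a^2-c^2&0\\0&0&1\end{pmatrix}: a,c\in\mathbb{R},\ a^2+c^2=1\right\}\cong S^1.$$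
   Context: A Lie bialgebra over a field $\mathbb{K}$ is a triple $(\mathfrak{g},[-,-],\delta)$ where $(\mathfrak{g},[-,-])$ is a Lie algebra over $\mathbb{K}$ and $\delta:\mathfrak{g}\to\Lambda^2\mathfrak{g}$ is a linear map (the cobracket) such that the induced map $\delta^*:\Lambda^2\mathfrak{g}^*\to\mathfrak{g}^*$ is a Lie algebra structure on $\mathfrak{g}^*$ (co-Jacobi condition) and $\delta$ is a 1-cocycle, i.e. $\delta[s,t]=[\delta s,t]+[s,\delta t]$ for all $s,t\in\mathfrak g$, with $\mathfrak{g}$ acting on $\Lambda^2\mathfrak{g}$ by the adjoint action ($[s,p\wedge q]=[s,p]\wedge q+p\wedge[s,q]$ and $[p\wedge q,s]=-[s,p\wedge q]$). An isomorphism of Lie bialgebras is a Lie algebra isomorphism $\phi$ with $\delta'\phi=(\phi\wedge\phi)\delta$; an automorphism is an isomorphism from a Lie bialgebra to itself. Matrix convention: the columns of the matrix of $\delta$ are the coordinates of $\delta(u),\delta(v),\delta(w)$ (in this order) in the ordered basis $\{u\wedge v,\,v\wedge w,\,w\wedge u\}$ of $\Lambda^2\mathfrak{g}$. *)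

(* Defs.v *)
From HB Require Import structures.
From mathcomp Require Import all_boot all_order all_algebra.
From mathcomp Require Import complex.
From mathcomp Require Import boolp classical_sets functions reals topology.
From mathcomp Require Import normedtype.

Set Implicit Arguments.
Unset Strict Implicit.
Unset Printing Implicit Defensive.

Import Order.TTheory GRing.Theory Num.Theory.
Import numFieldNormedType.Exports.

Local Open Scope classical_set_scope.
Local Open Scope ring_scope.

Section ExteriorSquare.
Variables (K : fieldType) (n : nat).

Definition alternating : {pred 'M[K]_n} :=
  [pred A : 'M[K]_n | (A^T == - A) && [forall i, A i i == 0]].

Lemma alternating_submod_closed : submod_closed alternating.
Proof.
split=> [|a A B]; rewrite !inE.
  by rewrite trmx0 oppr0 eqxx; apply/forallP => i; rewrite mxE.
move=> /andP[/eqP tA /forallP dA] /andP[/eqP tB /forallP dB].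
apply/andP; split.
  by rewrite linearP /= tA tB opprD scalerN.
by apply/forallP => i; rewrite !mxE (eqP (dA i)) (eqP (dB i)) mulr0 addr0.
Qed.

HB.instance Definition _ :=
  GRing.isSubmodClosed.Build K 'M[K]_n alternating alternating_submod_closed.

(* The exterior square of K^n, realized in every characteristic as the space
   of alternating matrices: e_i /\ e_j is E_ij - E_ji (see [wedge]). *)
Record ext2 := Ext2 { ext2_mx : 'M[K]_n; ext2P : ext2_mx \in alternating }.

HB.instance Definition _ := [isSub for ext2_mx].
HB.instance Definition _ := [Choice of ext2 by <:].
HB.instance Definition _ := [SubChoice_isSubLmodule of ext2 by <:].

Lemma wedge_subproof (p q : 'cV[K]_n) : p *m q^T - q *m p^T \in alternating.
Proof.
rewrite inE; apply/andP; split.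
  by rewrite linearB /= !trmx_mul !trmxK opprB.
by apply/forallP => i; rewrite !mxE !big_ord1 !mxE mulrC subrr.
Qed.

Definition wedge (p q : 'cV[K]_n) : ext2 := Ext2 (wedge_subproof p q).

Definition basis_vec (i : 'I_n) : 'cV[K]_n := delta_mx i 0.

(* The linear map on the exterior square induced by an alternating bilinear
   map f, i.e. the one sending p /\ q to f p q (see [ext2_lift_wedge]). *)
Definition ext2_lift (W : lmodType K) (f : 'cV[K]_n -> 'cV[K]_n -> W)
    (A : ext2) : W :=
  \sum_(i < n) \sum_(j < n | (i < j)%N)
     ext2_mx A i j *: f (basis_vec i) (basis_vec j).

Lemma ext2_lift_wedge (W : lmodType K) (f : 'cV[K]_n -> 'cV[K]_n -> W) :
  (forall p, linear (f p)) -> (forall q, linear (f^~ q)) ->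
  (forall p, f p p = 0) ->
  forall p q, ext2_lift f (wedge p q) = f p q.
Proof.
move=> linr linl alt p q.
have fDr r : {morph f r : x y / x + y} by move=> x y; have := linr r 1 x y; rewrite !scale1r.
have fDl r : {morph f^~ r : x y / x + y} by move=> x y; have := linl r 1 x y; rewrite !scale1r.
have f0r r : f r 0 = 0 by apply: (addIr (f r 0)); rewrite -fDr !add0r.
have f0l r : f 0 r = 0 by apply: (addIr (f 0 r)); rewrite -(fDl r) !add0r.
have fZr r a x : f r (a *: x) = a *: f r x.
  by have := linr r a x 0; rewrite f0r !addr0.
have fZl r a x : f (a *: x) r = a *: f x r.
  by have := linl r a x 0; rewrite f0l !addr0.
have fC x y : f y x = - f x y.
  apply/eqP; rewrite -addr_eq0; apply/eqP.
  by rewrite -[RHS](alt (x + y)) fDr !(fDl _) !alt add0r addr0.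
have dec (x : 'cV[K]_n) : x = \sum_i x i 0 *: basis_vec i.
  rewrite {1}[x]matrix_sum_delta; apply: eq_bigr => i _.
  by rewrite big_ord1.
pose t i j := (p i 0 * q j 0) *: f (basis_vec i) (basis_vec j).
have -> : f p q = \sum_i \sum_j t i j.
  rewrite {1}(dec p) (big_morph (f^~ q) (fDl q) (f0l q)); apply: eq_bigr => i _.
  rewrite {1}(dec q) (big_morph (f _) (fDr _) (f0r _)); apply: eq_bigr => j _.
  by rewrite fZl fZr scalerA.
have split_sum i : \sum_j t i j =
    \sum_(j < n | (i < j)%N) t i j + \sum_(j < n | (j < i)%N) t i j.
  rewrite (bigID (fun j : 'I_n => (i < j)%N)) /=; congr (_ + _).
  rewrite (bigID (fun j : 'I_n => j == i)) /= big1 ?add0r => [|j /andP[_ /eqP->]].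
    by apply: eq_bigl => j; rewrite -leqNgt ltn_neqAle andbC.
  by rewrite /t alt scaler0.
rewrite (eq_bigr _ (fun i _ => split_sum i)) big_split /=.
rewrite [X in _ + X](exchange_big_dep predT) //= -big_split /=.
apply: eq_bigr => i _; rewrite -big_split /=; apply: eq_bigr => j _.
rewrite /t !mxE !big_ord1 !mxE (fC (basis_vec i) (basis_vec j)).
by rewrite scalerN scalerBl [q i 0 * _]mulrC.
Qed.

End ExteriorSquare.

Section LieBialgebras.
Variable K : fieldType.

Definition is_lie_bracket (V : lmodType K) (br : V -> V -> V) : Prop :=
  [/\ forall x, linear (br x),
      forall y, linear (br^~ y),
      forall x, br x x = 0
    & forall x y z, br x (br y z) + br y (br z x) + br z (br x y) = 0].

Section Cobracket.
Variables (n : nat) (br : 'cV[K]_n -> 'cV[K]_n -> 'cV[K]_n).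
Variable (delta : 'cV[K]_n -> ext2 K n).

Definition ad_ext2 (s : 'cV[K]_n) : ext2 K n -> ext2 K n :=
  ext2_lift (fun p q => wedge (br s p) q + wedge p (br s q)).

(* The dual of K^n is the space of row vectors. *)
Definition dual_eval (xi : 'rV[K]_n) (p : 'cV[K]_n) : K := (xi *m p) 0 0.

(* The pairing of xi /\ eta with the exterior square. *)
Definition ext2_pairing (xi eta : 'rV[K]_n) : ext2 K n -> K^o :=
  ext2_lift (fun p q =>
    dual_eval xi p * dual_eval eta q - dual_eval xi q * dual_eval eta p : K^o).

(* (xi, eta) |-> delta^* (xi /\ eta) *)
Definition dual_bracket (xi eta : 'rV[K]_n) : 'rV[K]_n :=
  \row_j ext2_pairing xi eta (delta (basis_vec K j)).

Definition is_lie_bialgebra : Prop :=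
  [/\ is_lie_bracket br,
      linear delta,
      is_lie_bracket dual_bracket
    & forall s t,
        delta (br s t) = - ad_ext2 t (delta s) + ad_ext2 s (delta t)].

End Cobracket.

Definition ext2_map (n m : nat) (phi : 'cV[K]_n -> 'cV[K]_m) :
    ext2 K n -> ext2 K m :=
  ext2_lift (fun p q => wedge (phi p) (phi q)).

Definition is_lie_bialgebra_iso (n m : nat)
    (br : 'cV[K]_n -> 'cV[K]_n -> 'cV[K]_n) (delta : 'cV[K]_n -> ext2 K n)
    (br' : 'cV[K]_m -> 'cV[K]_m -> 'cV[K]_m) (delta' : 'cV[K]_m -> ext2 K m)
    (phi : 'cV[K]_n -> 'cV[K]_m) : Prop :=
  [/\ linear phi,
      bijective phi,
      forall x y, phi (br x y) = br' (phi x) (phi y)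
    & forall x, delta' (phi x) = ext2_map phi (delta x)].

Definition lie_bialgebra_isomorphic (n m : nat)
    (br : 'cV[K]_n -> 'cV[K]_n -> 'cV[K]_n) (delta : 'cV[K]_n -> ext2 K n)
    (br' : 'cV[K]_m -> 'cV[K]_m -> 'cV[K]_m) (delta' : 'cV[K]_m -> ext2 K m)
    : Prop :=
  exists phi, is_lie_bialgebra_iso br delta br' delta' phi.

(* The automorphism group, as a set of matrices in the standard basis. *)
Definition lie_bialgebra_aut_mx (n : nat)
    (br : 'cV[K]_n -> 'cV[K]_n -> 'cV[K]_n) (delta : 'cV[K]_n -> ext2 K n)
    : set 'M[K]_n :=
  [set P | is_lie_bialgebra_iso br delta br delta (mulmx P)].

Definition mx3 (rows : seq (seq K)) : 'M[K]_3 :=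
  \matrix_(i < 3, j < 3) (nth [::] rows i)`_j.

Definition e_u : 'cV[K]_3 := basis_vec K (inord 0).
Definition e_v : 'cV[K]_3 := basis_vec K (inord 1).
Definition e_w : 'cV[K]_3 := basis_vec K (inord 2).

(* The cobracket whose matrix with respect to the bases (u, v, w) and
   (u /\ v, v /\ w, w /\ u) is M. *)
Definition cobracket_of_mx (M : 'M[K]_3) (x : 'cV[K]_3) : ext2 K 3 :=
  let y := M *m x in
  y (inord 0) 0 *: wedge e_u e_v + y (inord 1) 0 *: wedge e_v e_w
    + y (inord 2) 0 *: wedge e_w e_u.

End LieBialgebras.

Section SU2.
Variable R : realType.

(* The bilinear alternating extension of [u,v] = w, [v,w] = u, [w,u] = v. *)
Definition su2_bracket (x y : 'cV[R]_3) : 'cV[R]_3 :=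
  let d i j := x (inord i) 0 * y (inord j) 0 - x (inord j) 0 * y (inord i) 0 in
  d 0%N 1%N *: e_w R + d 1%N 2%N *: e_u R + d 2%N 0%N *: e_v R.

Definition su2_cobracket (alpha : R) : 'cV[R]_3 -> ext2 R 3 :=
  cobracket_of_mx (mx3 [:: [::      0;     0; 0];
                           [::      0; alpha; 0];
                           [:: - alpha;    0; 0]]).

(* R[i]^o is R[i] with the topology of its norm. *)
Definition unit_circle : set (R[i])^o := [set z | `|z| = 1].

(* G, with matrix multiplication and the topology of 'M[R]_n, is isomorphic to
   the circle group, algebraically and topologically. *)
Definition mx_group_iso_circle (n : nat) (G : set 'M[R]_n) : Prop :=
  exists (f : (R[i])^o -> 'M[R]_n) (g : 'M[R]_n -> (R[i])^o),
    [/\ forall z, unit_circle z -> G (f z) /\ g (f z) = z,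
        forall P, G P -> unit_circle (g P) /\ f (g P) = P,
        forall z t, unit_circle z -> unit_circle t -> f (z * t) = f z *m f t,
        {within unit_circle, continuous f}
      & {within G, continuous g}].

End SU2.

(* Main.v *)
(* Identify the exterior square of su(2), i.e. R^3 with the cross product, with
   R^3 by the Hodge star.
   The adjoint action on it is then the adjoint action on R^3, so a 1-cocycle
   is a derivation, hence x |-> [r, x] for a unique vector r, and the co-Jacobi
   identity is automatic. A Lie algebra automorphism phi is a rotation, it acts
   on the exterior square as phi, and it is an isomorphism from the cobracket
   of r to that of s iff phi r = s. As delta_alpha corresponds to - alpha w, the
   classes are indexed by |r| = alpha, and the automorphisms of delta_alpha are
   the rotations about w. *)
From HB Require Import structures.
Require Import Defs.
From mathcomp Require Import all_boot all_order all_algebra.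
From mathcomp Require Import boolp classical_sets functions reals.
From mathcomp Require Import complex topology normedtype ring lra.

Set Implicit Arguments.
Unset Strict Implicit.
Unset Printing Implicit Defensive.

Import Order.TTheory GRing.Theory Num.Theory.
Import numFieldNormedType.Exports.
Local Open Scope classical_set_scope.
Local Open Scope ring_scope.

(** * Sums, case analysis and disequalities for the indices [inord 0], [inord 1], [inord 2] *)

Lemma big_inord3 (V : nmodType) (F : 'I_3 -> V) :
  \sum_i F i = F (inord 0) + F (inord 1) + F (inord 2).
Proof.
rewrite !big_ord_recl big_ord0 addr0 addrA.
by congr (F _ + F _ + F _); apply/val_inj; rewrite /= inordK.
Qed.

Lemma inord3P (P : 'I_3 -> Prop) :
  P (inord 0) -> P (inord 1) -> P (inord 2) -> forall i, P i.
Proof.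
move=> P0 P1 P2 i; rewrite -(inord_val i).
by case: i => -[|[|[|]]].
Qed.

Lemma inord3_eqE :
  (((inord 0 == inord 1 :> 'I_3) = false) *
   ((inord 1 == inord 0 :> 'I_3) = false) *
   ((inord 0 == inord 2 :> 'I_3) = false) *
   ((inord 2 == inord 0 :> 'I_3) = false) *
   ((inord 1 == inord 2 :> 'I_3) = false) *
   ((inord 2 == inord 1 :> 'I_3) = false))%type.
Proof. by do !split; rewrite -val_eqE /= !inordK. Qed.

(** * The exterior square in dimension three and the Hodge star *)

Section ExteriorSquareTheory.
Variables (K : fieldType).

Lemma ext2_lift_linear n (W : lmodType K) (f : 'cV[K]_n -> 'cV[K]_n -> W) :
  linear (ext2_lift f).
Proof.
move=> a A B; rewrite /ext2_lift scaler_sumr -big_split; apply: eq_bigr => i _.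
rewrite /= scaler_sumr -big_split; apply: eq_bigr => j _.
by rewrite /= !mxE scalerDl scalerA.
Qed.

(** The Hodge star: [u], [v], [w] go to [v /\ w], [w /\ u], [u /\ v], a cyclic shift of the basis
    order used by [cobracket_of_mx]. *)
Definition hodge (y : 'cV[K]_3) : ext2 K 3 :=
  y (inord 0) 0 *: wedge (e_v K) (e_w K)
    + y (inord 1) 0 *: wedge (e_w K) (e_u K)
    + y (inord 2) 0 *: wedge (e_u K) (e_v K).

Lemma hodge_entries (y : 'cV[K]_3) :
  [/\ ext2_mx (hodge y) (inord 1) (inord 2) = y (inord 0) 0,
      ext2_mx (hodge y) (inord 2) (inord 0) = y (inord 1) 0
    & ext2_mx (hodge y) (inord 0) (inord 1) = y (inord 2) 0].
Proof.
by split; rewrite /= !mxE !big_ord1 !mxE !inord3_eqE !eqxx /=; ring.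
Qed.

Lemma ext2_mx_sym n (A : ext2 K n) i j : ext2_mx A i j = - ext2_mx A j i.
Proof.
by case: A => A /= /andP[/eqP/matrixP/(_ j i)]; rewrite !mxE.
Qed.

Lemma ext2_mx_diag n (A : ext2 K n) i : ext2_mx A i i = 0.
Proof. by case: A => A /= /andP[_ /forallP/(_ i)/eqP]. Qed.

Lemma ext2_mx_linear n a (A B : ext2 K n) i j :
  ext2_mx (a *: A + B) i j = a * ext2_mx A i j + ext2_mx B i j.
Proof. by rewrite /= !mxE. Qed.

(** Antisymmetry and the zero diagonal recover the other six entries. The three chosen ones are in
    cyclic order, so they are the coordinates under [hodge] without signs. *)
Lemma ext2_3P (A B : ext2 K 3) :
  ext2_mx A (inord 1) (inord 2) = ext2_mx B (inord 1) (inord 2) ->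
  ext2_mx A (inord 2) (inord 0) = ext2_mx B (inord 2) (inord 0) ->
  ext2_mx A (inord 0) (inord 1) = ext2_mx B (inord 0) (inord 1) -> A = B.
Proof.
move=> h0 h1 h2; apply/val_inj/matrixP => /=.
apply: inord3P; apply: inord3P; rewrite ?ext2_mx_diag //.
- by rewrite ext2_mx_sym h1 -ext2_mx_sym.
- by rewrite ext2_mx_sym h2 -ext2_mx_sym.
- by rewrite ext2_mx_sym h0 -ext2_mx_sym.
Qed.

Lemma cV3P (x y : 'cV[K]_3) :
  x (inord 0) 0 = y (inord 0) 0 -> x (inord 1) 0 = y (inord 1) 0 ->
  x (inord 2) 0 = y (inord 2) 0 -> x = y.
Proof.
by move=> h0 h1 h2; apply/colP; apply: inord3P.
Qed.

Definition vec3 (a b c : K) : 'cV[K]_3 := \col_i nth 0 [:: a; b; c] i.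

Lemma vec3E a b c :
  ((vec3 a b c (inord 0) 0 = a) * (vec3 a b c (inord 1) 0 = b) *
   (vec3 a b c (inord 2) 0 = c))%type.
Proof. by rewrite !mxE !inordK. Qed.

Lemma hodge_linear : linear hodge.
Proof.
move=> a x y; have [h0 h1 h2] := hodge_entries x.
have [k0 k1 k2] := hodge_entries y.
have [l0 l1 l2] := hodge_entries (a *: x + y).
by apply: ext2_3P; rewrite ext2_mx_linear ?(l0, l1, l2) ?(h0, h1, h2)
  ?(k0, k1, k2) !mxE.
Qed.

HB.instance Definition _ :=
  GRing.isLinear.Build K 'cV[K]_3 (ext2 K 3) *:%R hodge hodge_linear.

Lemma hodgeD x y : hodge (x + y) = hodge x + hodge y.
Proof. exact: linearD. Qed.

Lemma hodgeZ a x : hodge (a *: x) = a *: hodge x.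
Proof. exact: linearZ. Qed.

Lemma hodgeN x : hodge (- x) = - hodge x.
Proof. exact: linearN. Qed.

Lemma hodge_comb a b c x y z :
  a *: hodge x + b *: hodge y + c *: hodge z = hodge (a *: x + b *: y + c *: z).
Proof. by rewrite !hodgeD !hodgeZ. Qed.

Lemma hodge_inj : injective hodge.
Proof.
move=> x y exy; have [h0 h1 h2] := hodge_entries x.
have [k0 k1 k2] := hodge_entries y.
by apply: cV3P; rewrite -?(h0, h1, h2) exy.
Qed.

Definition unhodge (A : ext2 K 3) : 'cV[K]_3 :=
  vec3 (ext2_mx A (inord 1) (inord 2)) (ext2_mx A (inord 2) (inord 0))
       (ext2_mx A (inord 0) (inord 1)).

Lemma unhodgeK : cancel unhodge hodge.
Proof.
move=> A; have [h0 h1 h2] := hodge_entries (unhodge A).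
by apply: ext2_3P; rewrite ?(h0, h1, h2) !vec3E.
Qed.

(** The adjoint action, the pairing and [ext2_map] are all lifts of this kind, so each is reduced to
    its values on three wedges of basis vectors. *)
Lemma ext2_lift_hodge (W : lmodType K) (f : 'cV[K]_3 -> 'cV[K]_3 -> W) y :
  (forall p, linear (f p)) -> (forall q, linear (f^~ q)) ->
  (forall p, f p p = 0) ->
  ext2_lift f (hodge y) = y (inord 0) 0 *: f (e_v K) (e_w K)
    + y (inord 1) 0 *: f (e_w K) (e_u K) + y (inord 2) 0 *: f (e_u K) (e_v K).
Proof.
move=> lr ll alt.
pose F := GRing.isLinear.Build K (ext2 K 3) W *:%R (ext2_lift f)
  (ext2_lift_linear f).
pose L : {linear ext2 K 3 -> W} := HB.pack (ext2_lift f) F.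
rewrite -[LHS]/(L _) !linearD !linearZ /=.
by rewrite !ext2_lift_wedge.
Qed.

End ExteriorSquareTheory.

(** * The cross product as the Lie bracket of su(2) *)

Section CrossProduct.
Variable R : realType.
Implicit Types (x y z r s t : 'cV[R]_3) (delta : 'cV[R]_3 -> ext2 R 3).

Local Notation cross := (@su2_bracket R).

Lemma crossE x y :
  ((cross x y (inord 0) 0
      = x (inord 1) 0 * y (inord 2) 0 - x (inord 2) 0 * y (inord 1) 0) *
   (cross x y (inord 1) 0
      = x (inord 2) 0 * y (inord 0) 0 - x (inord 0) 0 * y (inord 2) 0) *
   (cross x y (inord 2) 0
      = x (inord 0) 0 * y (inord 1) 0 - x (inord 1) 0 * y (inord 0) 0))%type.
Proof. by do !split; rewrite !mxE !inord3_eqE !eqxx /=; ring. Qed.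

Lemma e_uE : e_u R = vec3 1 0 0.
Proof. by apply: cV3P; rewrite vec3E !mxE ?inord3_eqE ?eqxx. Qed.

Lemma e_vE : e_v R = vec3 0 1 0.
Proof. by apply: cV3P; rewrite vec3E !mxE ?inord3_eqE ?eqxx. Qed.

Lemma e_wE : e_w R = vec3 0 0 1.
Proof. by apply: cV3P; rewrite vec3E !mxE ?inord3_eqE ?eqxx. Qed.

Lemma e_u_neq0 : e_u R != 0.
Proof.
apply/eqP; rewrite e_uE => /matrixP/(_ (inord 0) 0).
by rewrite vec3E mxE => /eqP; rewrite oner_eq0.
Qed.

Definition eE := (e_uE, e_vE, e_wE).

Lemma cross_linear x : linear (cross x).
Proof. by move=> a y z; apply: cV3P; rewrite !(crossE, mxE); ring. Qed.

HB.instance Definition _ x :=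
  GRing.isLinear.Build R 'cV[R]_3 'cV[R]_3 *:%R (cross x) (cross_linear x).

Lemma crossC x y : cross x y = - cross y x.
Proof. by apply: cV3P; rewrite !(crossE, mxE); ring. Qed.

Lemma cross_linearl y : linear (cross^~ y).
Proof. by move=> a x z; apply: cV3P; rewrite !(crossE, mxE); ring. Qed.

Lemma crossxx x : cross x x = 0.
Proof. by apply: cV3P; rewrite !(crossE, mxE); ring. Qed.

Lemma cross_is_lie_bracket : is_lie_bracket cross.
Proof.
split; [exact: cross_linear|exact: cross_linearl|exact: crossxx|].
by move=> x y z; apply: cV3P; rewrite !(crossE, mxE); ring.
Qed.

Lemma cross_uv : cross (e_u R) (e_v R) = e_w R.
Proof. by rewrite !eE; apply: cV3P; rewrite !(crossE, vec3E); ring. Qed.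

Lemma cross_vw : cross (e_v R) (e_w R) = e_u R.
Proof. by rewrite !eE; apply: cV3P; rewrite !(crossE, vec3E); ring. Qed.

Lemma cross_wu : cross (e_w R) (e_u R) = e_v R.
Proof. by rewrite !eE; apply: cV3P; rewrite !(crossE, vec3E); ring. Qed.

Lemma vec3_decomp x : x = x (inord 0) 0 *: e_u R + x (inord 1) 0 *: e_v R
  + x (inord 2) 0 *: e_w R.
Proof. by apply: cV3P; rewrite !eE !mxE !inordK //=; ring. Qed.

Lemma linear_e_decomp (V : lmodType R) (phi : 'cV[R]_3 -> V) x : linear phi ->
  phi x = x (inord 0) 0 *: phi (e_u R) + x (inord 1) 0 *: phi (e_v R)
    + x (inord 2) 0 *: phi (e_w R).
Proof.
move=> lphi; pose F := GRing.isLinear.Build R 'cV[R]_3 V *:%R phi lphi.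
pose L : {linear 'cV[R]_3 -> V} := HB.pack phi F.
by rewrite {1}(vec3_decomp x) -[LHS]/(L _) !linearD !linearZ.
Qed.

(** The centre is trivial: bracketing with [u] and [v] already reads off all three coordinates. *)
Lemma cross_inj x y : (forall z, cross x z = cross y z) -> x = y.
Proof.
move=> exy; have := exy (e_u R); have := exy (e_v R); rewrite !eE.
move=> /matrixP exv /matrixP exu.
have := (exv (inord 0) 0, exv (inord 2) 0, exu (inord 2) 0).
rewrite !(crossE, vec3E) => -[[h0 h1] h2].
by apply: cV3P; lra.
Qed.

(** * The adjoint action through the Hodge star *)

Lemma wedgeE x y : wedge x y = hodge (cross x y).
Proof.
have [h0 h1 h2] := hodge_entries (cross x y).
by apply: ext2_3P; rewrite ?(h0, h1, h2) crossE /= !mxE !big_ord1 !mxE; ring.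
Qed.

Lemma cross_derivation s x y :
  cross (cross s x) y + cross x (cross s y) = cross s (cross x y).
Proof. by apply: cV3P; rewrite [LHS]mxE !crossE; ring. Qed.

Lemma ad_wedge s x y :
  wedge (cross s x) y + wedge x (cross s y) = hodge (cross s (cross x y)).
Proof. by rewrite -cross_derivation hodgeD !wedgeE. Qed.

(** By the Jacobi identity, [s] sends [p /\ q] to the Hodge image of [[s,[p,q]]]; on the three basis
    wedges [[p,q]] is again a basis vector, and linearity does the rest. *)
Lemma ad_ext2_hodge s y : ad_ext2 cross s (hodge y) = hodge (cross s y).
Proof.
rewrite /ad_ext2 ext2_lift_hodge.
- rewrite !ad_wedge hodge_comb cross_uv cross_vw cross_wu.
  by rewrite -linear_e_decomp //; exact: cross_linear.
- by move=> p a x z; rewrite !ad_wedge cross_linear cross_linear hodgeD hodgeZ.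
- by move=> p a x z; rewrite !ad_wedge cross_linearl cross_linear hodgeD hodgeZ.
- by move=> p; rewrite ad_wedge crossxx linear0; exact: linear0.
Qed.

(** * The scalar product, dual brackets and the co-Jacobi identity *)

Definition dot x y : R := x (inord 0) 0 * y (inord 0) 0
  + x (inord 1) 0 * y (inord 1) 0 + x (inord 2) 0 * y (inord 2) 0.

Lemma dual_evalE (xi : 'rV[R]_3) x : dual_eval xi x = dot xi^T x.
Proof. by rewrite /dual_eval !mxE big_inord3 /dot !mxE. Qed.

(** A form of the Cauchy-Binet identity: 2 by 2 determinants of pairings become a scalar product of
    Hodge duals. *)
Lemma ext2_pairing_hodge (xi eta : 'rV[R]_3) y :
  ext2_pairing xi eta (hodge y) = dot (cross xi^T eta^T) y.
Proof.
rewrite /ext2_pairing ext2_lift_hodge.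
- rewrite !dual_evalE /dot !crossE !eE !vec3E !mxE /GRing.scale /=; ring.
- by move=> p a x z; rewrite !dual_evalE /dot !mxE /GRing.scale /=; ring.
- by move=> p a x z; rewrite !dual_evalE /dot !mxE /GRing.scale /=; ring.
- by move=> p; rewrite !dual_evalE /dot !mxE; ring.
Qed.

Definition inner_cobracket r x : ext2 R 3 := hodge (cross r x).

(** Since [z.[r,x] = [z,r].x], the transpose of bracketing with [r] on the left is bracketing with
    [r] on the right. *)
Lemma dual_bracket_inner r (xi eta : 'rV[R]_3) :
  dual_bracket (inner_cobracket r) xi eta = (cross (cross xi^T eta^T) r)^T.
Proof.
apply/rowP; rewrite /dual_bracket /inner_cobracket; apply: inord3P;
  rewrite [LHS]mxE [RHS]mxE ext2_pairing_hodge.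
- by rewrite -/(e_u R) eE /dot !(crossE, vec3E, mxE); ring.
- by rewrite -/(e_v R) eE /dot !(crossE, vec3E, mxE); ring.
- by rewrite -/(e_w R) eE /dot !(crossE, vec3E, mxE); ring.
Qed.

(** By [[a,[b,c]] = (a.c) b - (a.b) c], the first summand is [(x.r) [[y,z],r]]. The cyclic sum of
    [(x.r) [y,z]] is [det(x,y,z) r], which [r] annihilates. *)
Lemma cross_cojacobi r x y z :
  cross (cross x (cross (cross y z) r)) r
    + cross (cross y (cross (cross z x) r)) r
    + cross (cross z (cross (cross x y) r)) r = 0.
Proof.
by apply: cV3P; rewrite [LHS]mxE [X in X + _]mxE !crossE [RHS]mxE; ring.
Qed.

Lemma inner_cobracket_lie_bialgebra r :
  is_lie_bialgebra cross (inner_cobracket r).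
Proof.
split; first exact: cross_is_lie_bracket.
- by move=> a x y; rewrite /inner_cobracket !linearP.
- split=> [xi a x y|eta a x y|xi|x y z]; rewrite !dual_bracket_inner.
  + by rewrite linearP cross_linear cross_linearl linearP.
  + by rewrite linearP !cross_linearl linearP.
  + by rewrite crossxx crossC linear0 oppr0 trmx0.
  + have trD (a b c : 'cV[R]_3) : a^T + b^T + c^T = (a + b + c)^T.
      by rewrite !linearD.
    by rewrite !trmxK trD cross_cojacobi trmx0.
- move=> s t; rewrite /inner_cobracket !ad_ext2_hodge -hodgeN -hodgeD.
  by rewrite -cross_derivation (crossC (cross r s) t).
Qed.

(** Through the Hodge star the cocycle becomes a derivation [D]. The Leibniz rule on the three basis
    brackets makes its matrix antisymmetric, and an antisymmetric 3 by 3 matrix is a cross product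
    with a vector. *)
Lemma lie_bialgebra_inner delta :
  is_lie_bialgebra cross delta -> exists r, delta = inner_cobracket r.
Proof.
case=> _ ldelta _ cocycle.
have [D deltaE] : exists D, forall x, delta x = hodge (D x).
  by exists (fun x => unhodge (delta x)) => x; rewrite unhodgeK.
have derD x y : D (cross x y) = cross x (D y) - cross y (D x).
  apply: hodge_inj; rewrite hodgeD hodgeN -!ad_ext2_hodge -!deltaE cocycle.
  by rewrite addrC.
have linD a x y : D (a *: x + y) = a *: D x + D y.
  by apply: hodge_inj; rewrite hodgeD hodgeZ -!deltaE ldelta.
pose Du := D (e_u R); pose Dv := D (e_v R); pose Dw := D (e_w R).
(* The coordinates of [r] are read off [[r,v]], [[r,w]] and [[r,u]] respectively. *)
exists (vec3 (Dv (inord 2) 0) (Dw (inord 0) 0) (Du (inord 1) 0)).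
apply/funext => x; rewrite deltaE; congr hodge.
rewrite (linear_e_decomp x linD) -/Du -/Dv -/Dw.
have := derD (e_u R) (e_v R); have := derD (e_v R) (e_w R).
have := derD (e_w R) (e_u R).
rewrite cross_uv cross_vw cross_wu -/Du -/Dv -/Dw.
move: Du Dv Dw => Du Dv Dw; rewrite !eE.
move=> /matrixP hv /matrixP hu /matrixP hw.
have := (hv (inord 0) 0, hv (inord 1) 0, hv (inord 2) 0).
have := (hu (inord 0) 0, hu (inord 1) 0, hu (inord 2) 0).
have := (hw (inord 0) 0, hw (inord 1) 0, hw (inord 2) 0).
rewrite !(crossE, vec3E, mxE) ?inordK //=.
move=> -[[w0 w1] w2] [[u0 u1] u2] [[v0 v1] v2].
(* Each diagonal entry is the sum of the other two, so all three vanish; the remaining equations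
   give antisymmetry off the diagonal. *)
have u00 : Du (inord 0) 0 = 0 by lra.
have v11 : Dv (inord 1) 0 = 0 by lra.
have w22 : Dw (inord 2) 0 = 0 by lra.
have v0E : Dv (inord 0) 0 = - Du (inord 1) 0 by lra.
have w1E : Dw (inord 1) 0 = - Dv (inord 2) 0 by lra.
have u2E : Du (inord 2) 0 = - Dw (inord 0) 0 by lra.
by apply: cV3P; rewrite !(crossE, vec3E, mxE) ?inordK //=
  ?(u00, v11, w22, v0E, w1E, u2E); ring.
Qed.

(** * Inner cobrackets: the given family and isomorphisms *)

Lemma cobracket_of_mxE (M : 'M[R]_3) x :
  let y := M *m x in cobracket_of_mx M x
    = hodge (vec3 (y (inord 1) 0) (y (inord 2) 0) (y (inord 0) 0)).
Proof.
rewrite /cobracket_of_mx /=; move: (M *m x) => y.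
by rewrite /hodge !vec3E -[LHS]addrA addrC.
Qed.

(** Under the Hodge star the matrix sends [u] to [- alpha v], [v] to [alpha u] and [w] to 0, which
    is bracketing with [- alpha w]. *)
Lemma su2_cobracketE alpha :
  su2_cobracket alpha = inner_cobracket (- alpha *: e_w R).
Proof.
apply/funext => x; rewrite /su2_cobracket cobracket_of_mxE; congr hodge.
rewrite eE; apply: cV3P;
  by rewrite !(crossE, vec3E) !mxE !big_inord3 !mxE ?inordK //=; ring.
Qed.

Lemma ext2_map_hodge (phi : 'cV[R]_3 -> 'cV[R]_3) y :
  linear phi -> (forall x z, phi (cross x z) = cross (phi x) (phi z)) ->
  ext2_map phi (hodge y) = hodge (phi y).
Proof.
move=> lphi hphi; rewrite /ext2_map ext2_lift_hodge.
- rewrite !wedgeE -!hphi cross_uv cross_vw cross_wu.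
  rewrite hodge_comb; congr hodge.
  by rewrite -linear_e_decomp.
- by move=> p a x z; rewrite !wedgeE lphi linearP linearP.
- move=> p a x z; rewrite !wedgeE lphi -hodgeZ -hodgeD; congr hodge.
  exact: cross_linearl.
- by move=> p; rewrite wedgeE crossxx linear0.
Qed.

(** Compatibility with the cobrackets reads [[s, phi x] = phi [r,x] = [phi r, phi x]]; as [phi] is
    onto, [cross_inj] gives [phi r = s]. *)
Lemma inner_cobracket_isoP r s (phi : 'cV[R]_3 -> 'cV[R]_3) :
  is_lie_bialgebra_iso cross (inner_cobracket r) cross (inner_cobracket s) phi
  <-> [/\ linear phi, bijective phi,
          forall x y, phi (cross x y) = cross (phi x) (phi y) & phi r = s].
Proof.
split=> -[lphi bphi hphi]; last first.
  move=> <-; split=> // x.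
  by rewrite /inner_cobracket ext2_map_hodge // hphi.
move=> dphi; split=> //; apply: cross_inj => z.
case: (bphi) => psi _ psiK; rewrite -(psiK z) -hphi.
by apply: hodge_inj; rewrite -ext2_map_hodge // -dphi.
Qed.

(** * Automorphisms preserve lengths and are transitive on spheres *)

Lemma dot_crossC x y z : dot x (cross y z) = dot y (cross z x).
Proof. by rewrite /dot !crossE; ring. Qed.

Lemma dot_cross_cross x y :
  dot (cross x y) (cross x y) = dot x x * dot y y - dot x y ^+ 2.
Proof. by rewrite /dot !crossE; ring. Qed.

Lemma dotxx_ge0 x : 0 <= dot x x.
Proof. by rewrite /dot -!expr2 !addr_ge0 ?sqr_ge0. Qed.

Lemma dotxx_eq0 x : (dot x x == 0) = (x == 0).
Proof.
apply/eqP/eqP => [|->]; last by rewrite /dot !mxE; ring.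
rewrite /dot => h; have := (sqr_ge0 (x (inord 0) 0), sqr_ge0 (x (inord 1) 0),
  sqr_ge0 (x (inord 2) 0)) => -[[h0 h1] h2].
by apply: cV3P; rewrite mxE; apply/eqP; rewrite -sqrf_eq0; apply/eqP; lra.
Qed.

(** The images [f], [g], [h] of the basis are each the cross product of the other two, hence
    orthogonal, and cyclic invariance of the triple product makes their lengths equal. *)
Lemma dot_lie_automorphism (phi : 'cV[R]_3 -> 'cV[R]_3) x :
  linear phi -> injective phi ->
  (forall x y, phi (cross x y) = cross (phi x) (phi y)) ->
  dot (phi x) (phi x) = dot x x.
Proof.
move=> lphi iphi hphi.
have phi0 : phi 0 = 0.
  by have := lphi (-1) 0 0; rewrite scaler0 addr0 scaleN1r addNr.
pose f := phi (e_u R); pose g := phi (e_v R); pose h := phi (e_w R).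
have fg : cross f g = h by rewrite -hphi cross_uv.
have gh : cross g h = f by rewrite -hphi cross_vw.
have hf : cross h f = g by rewrite -hphi cross_wu.
have orth a b : dot a (cross b a) = 0.
  by rewrite dot_crossC crossxx /dot !mxE; ring.
have fg0 : dot f g = 0 by rewrite -hf orth.
have gh0 : dot g h = 0 by rewrite -fg orth.
have hf0 : dot h f = 0 by rewrite -gh orth.
have ffgg : dot f f = dot g g by rewrite -{2}gh dot_crossC hf.
have gghh : dot g g = dot h h by rewrite -{2}hf dot_crossC fg.
(* Orthogonality turns the norm of [[f,g] = h] into [|f|^2 = |f|^4], and [f] is nonzero by
   injectivity. *)
have ff1 : dot f f = 1.
  have := dot_cross_cross f g; rewrite fg fg0 -gghh -ffgg expr0n subr0.
  rewrite -{1}[dot f f]mulr1 => /esym/mulfI; apply; rewrite dotxx_eq0.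
  by rewrite -phi0 (inj_eq iphi) e_u_neq0.
have -> : phi x = x (inord 0) 0 *: f + x (inord 1) 0 *: g + x (inord 2) 0 *: h.
  exact: linear_e_decomp.
have expand a b c : dot (a *: f + b *: g + c *: h) (a *: f + b *: g + c *: h) =
   a ^+ 2 * dot f f + b ^+ 2 * dot g g + c ^+ 2 * dot h h
   + 2 * (a * b * dot f g + b * c * dot g h + c * a * dot h f).
  by rewrite /dot !mxE; ring.
by rewrite expand fg0 gh0 hf0 -gghh -ffgg ff1 /dot; ring.
Qed.

(** For nonzero [h], the rotation by pi about the axis of [h]: twice the projection minus the
    identity. A reflection would reverse the sign of cross products. *)
Definition half_turn (h x : 'cV[R]_3) : 'cV[R]_3 :=
  (2 * dot h x / dot h h) *: h - x.

Lemma half_turn_linear h : linear (half_turn h).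
Proof.
by move=> a x y; apply: cV3P; rewrite /half_turn /dot !mxE; ring.
Qed.

Lemma half_turnK h : h != 0 -> involutive (half_turn h).
Proof.
rewrite -dotxx_eq0 => h0 x.
by apply: cV3P; rewrite /half_turn /dot !mxE; field.
Qed.

Lemma half_turn_cross h x y : h != 0 ->
  half_turn h (cross x y) = cross (half_turn h x) (half_turn h y).
Proof.
rewrite -dotxx_eq0 => h0.
by apply: cV3P; rewrite /half_turn !(crossE, mxE) /dot !crossE; field.
Qed.

Lemma half_turn_swap x y : dot x x = dot y y -> x + y != 0 ->
  half_turn (x + y) x = y.
Proof.
move=> exy; rewrite -dotxx_eq0 => h0.
(* This uses [2 (x+y).x = |x+y|^2 + |x|^2 - |y|^2]; the axis [x + y] bisects two vectors of equal
   length. *)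
have -> : half_turn (x + y) x =
    ((dot x x - dot y y) / dot (x + y) (x + y)) *: (x + y) + y.
  rewrite /half_turn; move: h0; rewrite /dot !mxE => h0.
  by apply: cV3P; rewrite !mxE; field.
by rewrite exy subrr mul0r scale0r add0r.
Qed.

Lemma exists_lie_automorphism x y : dot x x = dot y y -> exists phi,
  [/\ linear phi, bijective phi,
      forall x y, phi (cross x y) = cross (phi x) (phi y) & phi x = y].
Proof.
move=> exy.
have [h h0 hx] : exists2 h, h != 0 & half_turn h x = y.
  have [xy0|xy0] := eqVneq (x + y) 0; last first.
    by exists (x + y) => //; exact: half_turn_swap.
  (* When [y = - x], any axis orthogonal to [x] works: [u] if [x] is a multiple of [w], and [[w,x]]
     otherwise. *)
  have [h h0 hx] : exists2 h, h != 0 & dot h x = 0.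
    have [->|x0] := eqVneq x 0.
      by exists (e_u R); [exact: e_u_neq0|rewrite /dot !mxE; ring].
    have [xu|xu] := eqVneq (cross (e_w R) x) 0.
      exists (e_u R); first exact: e_u_neq0.
      move/matrixP/(_ (inord 1) 0): xu.
      by rewrite eE /dot !(crossE, vec3E) eE !vec3E mxE => h; lra.
    exists (cross (e_w R) x) => //.
    by rewrite /dot !crossE; ring.
  exists h => //; rewrite /half_turn hx mulr0 mul0r scale0r add0r.
  by apply/eqP; rewrite eq_sym -addr_eq0 addrC xy0.
exists (half_turn h); split => //; first exact: half_turn_linear.
  by exists (half_turn h); exact: half_turnK.
by move=> ? ?; exact: half_turn_cross.
Qed.

End CrossProduct.

(** * Continuity of maps into matrices and of maps from and to the complex numbers *)

Section ComplexTopology.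

Lemma continuous_mx (T : topologicalType) (K : numFieldType) m n
    (f : T -> 'M[K]_(m, n)) :
  (forall i j, continuous (fun t => f t i j)) -> continuous f.
Proof.
move=> cf t A /nbhs_ballP[e /= e0 es].
have near_ij : \forall s \near t, forall i j, ball (f t i j) e (f s i j).
  apply: filter_forall => i; apply: filter_forall => j.
  by apply: cf; exact: nbhsx_ballx.
by apply: filterS near_ij => s fs; apply: es; split.
Qed.

Variable R : realType.

(** The norm of [R[i]] takes values in [R[i]], so radii of balls are complex; this brings the
    comparison back to [R]. *)
Lemma ltc_norm (z : R[i]) (e : R) : 0 < e ->
  (`|z| < e%:C%C) = (complex.Re z ^+ 2 + complex.Im z ^+ 2 < e ^+ 2).
Proof.
move=> e0; rewrite normc_def ltcR -[in LHS](gtr0_norm e0) -sqrtr_sqr.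
by rewrite ltr_sqrt // exprn_gt0.
Qed.

Lemma Re_continuous : continuous (@complex.Re R : (R[i])^o -> R).
Proof.
move=> z A /nbhs_ballP[e /= e0 es]; apply/nbhs_ballP; exists e%:C%C => /=.
  by rewrite ltcR.
move=> w; rewrite -ball_normE /= ltc_norm // => zw.
apply: es; rewrite -ball_normE /= -(ltr_pXn2r (n := 2)) ?nnegrE ?(ltW e0) //.
rewrite real_normK ?num_real //; move: z w zw => [a b] [c d] /=.
by apply: le_lt_trans; rewrite lerDl sqr_ge0.
Qed.

Lemma Im_continuous : continuous (@complex.Im R : (R[i])^o -> R).
Proof.
move=> z A /nbhs_ballP[e /= e0 es]; apply/nbhs_ballP; exists e%:C%C => /=.
  by rewrite ltcR.
move=> w; rewrite -ball_normE /= ltc_norm // => zw.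
apply: es; rewrite -ball_normE /= -(ltr_pXn2r (n := 2)) ?nnegrE ?(ltW e0) //.
rewrite real_normK ?num_real //; move: z w zw => [a b] [c d] /=.
by apply: le_lt_trans; rewrite lerDr sqr_ge0.
Qed.

Lemma continuous_complex (T : topologicalType) (f g : T -> R) :
  continuous f -> continuous g ->
  continuous ((fun t => (f t +i* g t)%C) : T -> (R[i])^o).
Proof.
move=> cf cg t A /nbhs_ballP[e0 /= e00 es].
(* Positivity in [R[i]] forces the imaginary part to vanish. *)
have [e e_gt0 e0E] : exists2 e : R, 0 < e & e0 = e%:C%C.
  by case: e0 e00 {es} => a b; rewrite ltcE /= => /andP[/eqP-> a0]; exists a.
have e2 : 0 < e / 2 by rewrite divr_gt0.
have near_fg : \forall s \near t,
    ball (f t) (e / 2) (f s) /\ ball (g t) (e / 2) (g s).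
  by apply: filterI; [apply: cf|apply: cg]; exact: nbhsx_ballx.
apply: filterS near_fg => s; rewrite -!ball_normE /= => -[fs gs].
apply: es; rewrite e0E -ball_normE /= ltc_norm //=.
move: fs gs; rewrite !ltr_norml => /andP[f1 f2] /andP[g1 g2].
have fe : (f t - f s) ^+ 2 < (e / 2) ^+ 2 by nra.
have ge : (g t - g s) ^+ 2 < (e / 2) ^+ 2 by nra.
by nra.
Qed.

End ComplexTopology.

(** * Rotations about [w], the automorphism group and the circle *)

Section SU2Rotations.
Variable R : realType.
Implicit Types (x y r : 'cV[R]_3) (P Q : 'M[R]_3) (p q alpha : R).

Local Notation cross := (@su2_bracket R).

Lemma dot_scale_e_w alpha :
  dot (- alpha *: e_w R) (- alpha *: e_w R) = alpha ^+ 2.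
Proof. by rewrite eE /dot !mxE ?inordK //=; ring. Qed.

(** An isomorphism is an automorphism carrying [r] to [- alpha w]: it preserves length, and it
    exists as soon as the lengths agree. *)
Lemma inner_cobracket_iso_su2 r alpha :
  lie_bialgebra_isomorphic cross (inner_cobracket r) cross (su2_cobracket alpha)
  <-> dot r r = alpha ^+ 2.
Proof.
rewrite su2_cobracketE -dot_scale_e_w; split.
  move=> [phi /inner_cobracket_isoP[lphi bphi hphi <-]].
  by rewrite dot_lie_automorphism //; exact: bij_inj.
move=> /exists_lie_automorphism[phi ?]; exists phi.
exact/inner_cobracket_isoP.
Qed.

Definition rotation p q : 'M[R]_3 :=
  mx3 [:: [:: p; - q; 0]; [:: q; p; 0]; [:: 0; 0; 1]].

Lemma rotation_mul p q x : rotation p q *m x =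
  vec3 (p * x (inord 0) 0 - q * x (inord 1) 0)
       (q * x (inord 0) 0 + p * x (inord 1) 0) (x (inord 2) 0).
Proof.
by apply: cV3P; rewrite vec3E !mxE big_inord3 !mxE !inordK //=; ring.
Qed.

Lemma mulmx_e_inj P Q : P *m e_u R = Q *m e_u R -> P *m e_v R = Q *m e_v R ->
  P *m e_w R = Q *m e_w R -> P = Q.
Proof.
rewrite -!colE => hu hv hw; apply: trmx_inj; apply/row_matrixP.
by apply: inord3P; rewrite -!tr_col ?hu ?hv ?hw.
Qed.

Lemma rotationM p q p' q' :
  rotation p q *m rotation p' q' = rotation (p * p' - q * q') (p * q' + q * p').
Proof.
by apply: mulmx_e_inj; rewrite -mulmxA !rotation_mul !eE;
  apply: cV3P; rewrite !vec3E; ring.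
Qed.

Lemma su2_aut_mxP alpha P : alpha != 0 ->
  lie_bialgebra_aut_mx cross (su2_cobracket alpha) P <->
  exists p q, p ^+ 2 + q ^+ 2 = 1 /\ P = rotation p q.
Proof.
move=> alpha0; rewrite su2_cobracketE /lie_bialgebra_aut_mx /=.
split=> [/inner_cobracket_isoP[_ _ hom]|[p [q [pq ->]]]].
  (* As [P] fixes [- alpha w] and [alpha] is nonzero, it fixes [w]; then [x], the image of [u],
     determines [P] because [v = [w,u]]. *)
  rewrite -scalemxAr => /scalerI; rewrite oppr_eq0 => /(_ alpha0) Pw.
  pose x := P *m e_u R.
  have Pv : P *m e_v R = cross (e_w R) x by rewrite -cross_wu hom Pw.
  have Pu : x = cross (cross (e_w R) x) (e_w R).
    by have := hom (e_v R) (e_w R); rewrite cross_vw Pv Pw.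
  have x2 : x (inord 2) 0 = 0 by rewrite Pu crossE eE !vec3E; ring.
  exists (x (inord 0) 0), (x (inord 1) 0); split.
    have : cross x (P *m e_v R) = e_w R by rewrite -hom cross_uv.
    rewrite Pv eE => /matrixP/(_ (inord 2) 0); rewrite !(crossE, vec3E) => <-.
    by ring.
  apply: mulmx_e_inj; rewrite rotation_mul.
  - by rewrite -/x eE; apply: cV3P; rewrite !vec3E ?x2; ring.
  - by rewrite Pv !eE; apply: cV3P; rewrite !(crossE, vec3E); ring.
  - by rewrite Pw !eE; apply: cV3P; rewrite !vec3E; ring.
have p2 : p ^+ 2 = 1 - q ^+ 2 by rewrite -pq addrK.
apply/inner_cobracket_isoP; split.
- by move=> a x y; rewrite mulmxDr scalemxAr.
(* The inverse is the rotation by the opposite angle. *)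
- exists (mulmx (rotation p (- q))) => x; rewrite !rotation_mul;
  by apply: cV3P; rewrite !vec3E //; ring: p2.
- by move=> x y; rewrite !rotation_mul; apply: cV3P; rewrite !(crossE, vec3E);
    ring: p2.
- by rewrite -scalemxAr rotation_mul !eE; congr (_ *: _); apply: cV3P;
    rewrite !vec3E; ring.
Qed.

(** With [p = cos t] and [q = sin t], the witnesses are [a = cos (t/2)], taken as the nonnegative
    root of [(1 + p)/2], and [c = q/(2a)]. The case [p = -1], where [a = 0], is treated apart. *)
Lemma half_angle p q : p ^+ 2 + q ^+ 2 = 1 ->
  exists a c, [/\ a ^+ 2 + c ^+ 2 = 1, p = a ^+ 2 - c ^+ 2 & q = 2 * a * c].
Proof.
move=> pq; have p1 : -1 <= p by nra.
have [pE|pN1] := eqVneq p (-1).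
  have q0 : q ^+ 2 = 0 by move: pq; rewrite pE => ?; lra.
  exists 0, 1; rewrite pE; split; [ring|ring|].
  by rewrite mulr0 mul0r; apply/eqP; rewrite -sqrf_eq0 q0.
have sp : Num.sqrt ((1 + p) / 2) ^+ 2 = (1 + p) / 2.
  by rewrite sqr_sqrtr //; lra.
have a0 : Num.sqrt ((1 + p) / 2) != 0.
  by rewrite -sqrf_eq0 sp; apply: contra pN1 => /eqP h; apply/eqP; lra.
move: (Num.sqrt _) sp a0 => a sp a0; exists a, (q / (2 * a)).
have -> : p = 2 * a ^+ 2 - 1 by rewrite sp; field.
have qE : q ^+ 2 = 4 * a ^+ 2 * (1 - a ^+ 2).
  rewrite sp; have -> : q ^+ 2 = 1 - p ^+ 2 by rewrite -pq; ring.
  by field.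
have cE : (q / (2 * a)) ^+ 2 = 1 - a ^+ 2.
  by rewrite exprMn qE; field.
by split; rewrite ?cE; [ring|ring|field].
Qed.

(** The point [p + iq] corresponds to [rotation p q], and [rotationM] is complex multiplication. The
    inverse reads [p] and [q] off the first column; both maps are continuous on the whole space. *)
Lemma rotation_group_iso_circle (G : set 'M[R]_3) :
  (forall P, G P <-> exists p q, p ^+ 2 + q ^+ 2 = 1 /\ P = rotation p q) ->
  mx_group_iso_circle G.
Proof.
move=> GP.
exists (fun z => rotation (complex.Re z) (complex.Im z)),
  (fun P => (P (inord 0) (inord 0) +i* P (inord 1) (inord 0))%C).
have circleP (z : R[i]) :
    unit_circle z <-> complex.Re z ^+ 2 + complex.Im z ^+ 2 = 1.
  rewrite /unit_circle /= normc_def; split=> [[]|->]; last by rewrite sqrtr1.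
  move=> /(congr1 (fun x : R => x ^+ 2)).
  by rewrite sqr_sqrtr ?expr1n // addr_ge0 ?sqr_ge0.
split.
- move=> [p q] /circleP /= pq; split; last by rewrite !mxE !inordK.
  by apply/GP; exists p, q.
- move=> P /GP[p [q [pq ->]]]; rewrite !mxE !inordK //=.
  by split=> //; apply/circleP.
- by move=> [p q] [p' q'] _ _; rewrite rotationM.
- apply: continuous_subspaceT; apply: continuous_mx.
  apply: inord3P; apply: inord3P; under eq_fun do rewrite mxE !inordK //=;
  do ?[exact: Re_continuous|exact: Im_continuous|exact: cst_continuous].
  by move=> z; apply: continuousN; exact: Im_continuous.
- apply: continuous_subspaceT; apply: continuous_complex;
    exact: coord_continuous.
Qed.

End SU2Rotations.

(** * Classification of the cobrackets and their automorphism groups *)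

Theorem proposition9p1 (R : realType) :
  [/\ forall alpha : R, 0 <= alpha ->
        is_lie_bialgebra (@su2_bracket R) (su2_cobracket alpha),
      forall delta : 'cV[R]_3 -> ext2 R 3,
        is_lie_bialgebra (@su2_bracket R) delta ->
        exists! alpha : R, 0 <= alpha /\
          lie_bialgebra_isomorphic (@su2_bracket R) delta
                                   (@su2_bracket R) (su2_cobracket alpha)
    & forall alpha : R, alpha != 0 ->
        lie_bialgebra_aut_mx (@su2_bracket R) (su2_cobracket alpha) =
          [set P | exists a c : R, a ^+ 2 + c ^+ 2 = 1 /\
             P = mx3 [:: [:: a ^+ 2 - c ^+ 2; - (2 * a * c); 0];
                         [:: 2 * a * c; a ^+ 2 - c ^+ 2; 0];
                         [:: 0; 0; 1]]]
        /\ mx_group_iso_circle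
             (lie_bialgebra_aut_mx (@su2_bracket R) (su2_cobracket alpha))].
Proof.
split.
- move=> alpha _; rewrite su2_cobracketE.
  exact: inner_cobracket_lie_bialgebra.
- move=> delta /lie_bialgebra_inner[r ->].
  (* The invariant is the length of [r], the only nonnegative root of [alpha ^+ 2 = dot r r]. *)
  exists (Num.sqrt (dot r r)); split=> [|alpha [alpha0]].
    split; first exact: sqrtr_ge0.
    by apply/inner_cobracket_iso_su2; rewrite sqr_sqrtr ?dotxx_ge0.
  by move=> /inner_cobracket_iso_su2 ->; rewrite sqrtr_sqr ger0_norm.
- move=> alpha alpha0; split.
    apply/seteqP; split=> P.
      move=> /su2_aut_mxP - /(_ alpha0)[p [q [pq ->]]].
      by have [a [c [ac -> ->]]] := half_angle pq; exists a, c.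
    move=> [a [c [ac ->]]]; apply/su2_aut_mxP => //.
    exists (a ^+ 2 - c ^+ 2), (2 * a * c); split=> //.
    by transitivity ((a ^+ 2 + c ^+ 2) ^+ 2); [ring|rewrite ac expr1n].
  by apply: rotation_group_iso_circle => P; exact: su2_aut_mxP.
Qed.
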